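(* Let $(f_n)_{n\geq 0}$ be a real recurrence sequence. Then the natural density of the set $\{n\in\mathbb{N} : f_n > 0\}$ exists.
   Context: A sequence $(f_n)_{n\geq 0}$ of real numbers is a recurrence sequence if there are $h\geq 1$ and constants $c_1,\dots,c_h\in\mathbb{R}$ with $f_{n+h} = c_1 f_{n+h-1} + \dots + c_h f_n$ for all $n\geq 0$. The natural density of $A\subseteq\mathbb{N}$ is $\boldsymbol{d}(A)=\lim_{x\to\infty}x^{-1}\#\{n\leq x : n\in A\}$, when this limit exists. *)

(* Defs.v *)
From HB Require Import structures.
From mathcomp Require Import all_boot all_order all_algebra finmap.
From mathcomp Require Import all_classical all_reals all_analysis.

Set Implicit Arguments.
Unset Strict Implicit.
Unset Printing Implicit Defensive.

Import Order.TTheory GRing.Theory Num.Theory.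
Import numFieldNormedType.Exports.

Local Open Scope classical_set_scope.
Local Open Scope ring_scope.

(* Only c 1, ..., c h matter; j <= h, so the nat subtraction never truncates. *)
Definition recurrence_sequence (R : realType) (f : nat -> R) : Prop :=
  exists h : nat, (1 <= h)%N /\
    exists c : nat -> R,
      forall n : nat, f (n + h)%N = \sum_(1 <= j < h.+1) c j * f (n + h - j)%N.

(* fset_set returns the empty set on infinite sets; here the set is finite,
   being bounded by x. *)
Definition counting_function (R : realType) (A : set nat) (x : R) : nat :=
  #|` fset_set [set n : nat | n%:R <= x /\ A n] |%fset.

Definition has_natural_density (R : realType) (A : set nat) (d : R) : Prop :=
  x^-1 * (counting_function A x)%:R @[x --> +oo] --> d.

(* Main.v *)
(** Up to finitely many terms, [f n] is an exponential polynomial. Restricting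
[n] to residue classes modulo a suitable [M] makes it nondegenerate: no quotient
of two distinct characteristic roots is a root of unity. On such a class, unless
it vanishes eventually, [f n = n^D rho^n (G n + o(1))], where
[G n = sum_u c_u u^n] is a nonzero trigonometric sum with [|u| = 1].

The indicator of [f n > 0] is compared with [phi (Re (G n))], where [phi] is a
continuous piecewise linear approximation of the indicator of the positive reals.
By uniform approximation of [|t|] by polynomials, [phi (Re (G n))] is a uniform
limit of trigonometric sums, hence has an average. The error is controlled by the
density of [{n : |G n| <= k}], which tends to [0] with [k]: otherwise, by the
pigeonhole principle, for some bounded [d > 0] both [G n] and [G (n + d)] are
small with positive density, hence so is [G (n + d) - w^d G n], which has one
frequency [w] less and, by nondegeneracy, is still nonzero; one concludes by
induction on the number of frequencies. *)

Require Import Defs.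
From HB Require Import structures.
From mathcomp Require Import all_boot all_order all_algebra finmap.
From mathcomp Require Import all_classical all_reals all_analysis.
From mathcomp Require Import complex ring lra zify.

Set Implicit Arguments.
Unset Strict Implicit.
Unset Printing Implicit Defensive.

Import Order.TTheory GRing.Theory Num.Theory.
Import numFieldNormedType.Exports.
Import Normc.

Local Open Scope classical_set_scope.
Local Open Scope ring_scope.
Local Open Scope complex_scope.

Local Notation Re := complex.Re.

(** * Averages of real sequences *)

Section Averages.
Variable R : realType.
Implicit Types (a b : nat -> R) (l m e : R).

Definition has_average a l : Prop :=
  forall e, 0 < e -> exists N0 : nat, forall N : nat, (N0 <= N)%N ->
    `|\sum_(i < N) a i - l * N%:R| <= e * N%:R.

(* Closeness in the Besicovitch seminorm. *)
Definition average_close a b e : Prop :=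
  exists N0 : nat, forall N : nat, (N0 <= N)%N ->
    \sum_(i < N) `|a i - b i| <= e * N%:R.

Lemma eventually_le_linear (K e : R) : 0 < e ->
  exists N0 : nat, forall N : nat, (N0 <= N)%N -> K <= e * N%:R.
Proof.
move=> e0; exists (Num.truncn (K / e)).+1 => N hN.
rewrite mulrC -ler_pdivrMr//.
apply: le_trans (ltW (truncnS_gt _)) _.
by rewrite ler_nat.
Qed.

Lemma has_average_bounded_sum a (K : R) :
  (forall N, `|\sum_(i < N) a i| <= K) -> has_average a 0.
Proof.
move=> hK e /(eventually_le_linear K)[N0 h0]; exists N0 => N /h0 hN.
by rewrite mul0r subr0; exact: le_trans (hK N) hN.
Qed.

Lemma has_average_cst (c : R) : has_average (fun=> c) c.
Proof.
move=> e e0; exists 0%N => N _.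
rewrite sumr_const card_ord mulr_natr subrr normr0.
by rewrite mulr_ge0 ?ler0n// ltW.
Qed.

Lemma has_averageD a b l m :
  has_average a l -> has_average b m ->
  has_average (fun n => a n + b n) (l + m).
Proof.
move=> ha hb e e0.
have e2 : 0 < e / 2 by lra.
have [N1 h1] := ha _ e2; have [N2 h2] := hb _ e2.
exists (maxn N1 N2) => N; rewrite geq_max => /andP[/h1 h3 /h2 h4].
rewrite big_split /=.
have -> : forall x y : R, x + y - (l + m) * N%:R =
  (x - l * N%:R) + (y - m * N%:R) by move=> x y; ring.
apply: le_trans (ler_normD _ _) _; lra.
Qed.

Lemma has_averageZ a l (c : R) :
  has_average a l -> has_average (fun n => c * a n) (c * l).
Proof.
move=> ha e e0.
have c1 : 0 < `|c| + 1 by apply: ltr_wpDl.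
have [N1 h1] := ha _ (divr_gt0 e0 c1).
exists N1 => N /h1 h; rewrite -mulr_sumr -mulrA -mulrBr normrM.
apply: (@le_trans _ _ ((`|c| + 1) * `|\sum_(i < N) a i - l * N%:R|)).
  by apply: ler_wpM2r => //; lra.
apply: le_trans (ler_wpM2l (ltW c1) h) _.
by rewrite mulrA mulrCA divff ?mulr1// gt_eqF.
Qed.

Lemma has_average_ext a b l : a =1 b -> has_average a l -> has_average b l.
Proof. by move=> /funext ->. Qed.

(* The average is the supremum of the eventual linear lower bounds of the
   partial sums. *)
Lemma has_average_approx a :
  (forall e, 0 < e -> exists b l, has_average b l /\ average_close a b e) ->
  exists l, has_average a l.
Proof.
move=> H.
(* First an average up to the error [e], with [l] still depending on [e]. *)
have H' e : 0 < e -> exists l (N0 : nat), forall N : nat, (N0 <= N)%N ->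
    `|\sum_(i < N) a i - l * N%:R| <= e * N%:R.
  move=> e0; have e2 : 0 < e / 2 by lra.
  have [b [l [hb [N1 h1]]]] := H _ e2.
  have [N2 h2] := hb _ e2.
  exists l, (maxn N1 N2) => N; rewrite geq_max => /andP[/h1 h3 /h2 h4].
  have h5 : `|\sum_(i < N) a i - \sum_(i < N) b i| <= e / 2 * N%:R.
    by apply: le_trans h3; rewrite -sumrB; exact: ler_norm_sum.
  rewrite -(subrK (\sum_(i < N) b i) (\sum_(i < N) a i)) -addrA.
  apply: le_trans (ler_normD _ _) _; lra.
pose S : set R := [set x | exists N0 : nat, forall N : nat, (N0 <= N)%N ->
  x * N%:R <= \sum_(i < N) a i].
have key e : 0 < e -> exists l, [/\ S (l - e), ubound S (l + e) &
    exists N0 : nat, forall N : nat, (N0 <= N)%N ->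
    `|\sum_(i < N) a i - l * N%:R| <= e * N%:R].
  move=> /H' [l [N0 h0]]; exists l; split; last by exists N0.
    by exists N0 => N /h0; rewrite ler_norml mulrBl; lra.
  (* An index beyond both thresholds, and positive so that [N%:R] can be cancelled. *)
  move=> x [N1 h1]; set N := (maxn N0 N1).+1.
  have /h0 : (N0 <= N)%N by rewrite leqW// leq_maxl.
  have /h1 h : (N1 <= N)%N by rewrite leqW// leq_maxr.
  rewrite ler_norml => /andP[_ h2].
  have N0' : 0 < N%:R :> R by rewrite ltr0n.
  rewrite -(ler_pM2r N0'); nra.
have supS : has_sup S.
  have [l [h1 h2 _]] := key 1 ltr01.
  by split; [exists (l - 1) | exists (l + 1)].
exists (sup S) => e e0; have e2 : 0 < e / 2 by lra.
have [l [h1 h2 [N0 h0]]] := key _ e2.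
exists N0 => N /h0; rewrite !ler_norml => /andP[h3 h4].
have h5 : l - e / 2 <= sup S by apply: ub_le_sup => //; case: supS.
have h6 : sup S <= l + e / 2 by apply: ge_sup => //; case: supS.
have N0' : 0 <= N%:R :> R by rewrite ler0n.
have := ler_wpM2r N0' h5; have := ler_wpM2r N0' h6.
rewrite mulrDl mulrBl => h7 h8.
apply/andP; split; lra.
Qed.

Lemma sum_residue_classes a (M q : nat) :
  \sum_(i < q * M) a i = \sum_(r < M) \sum_(n < q) a (n * M + r)%N.
Proof.
elim: q => [|q IH].
  by rewrite mul0n big_ord0 big1// => r _; rewrite big_ord0.
rewrite mulSn addnC big_split_ord /= IH -big_split /=.
by apply: eq_bigr => r _; rewrite big_ord_recr.
Qed.

(** The first [N = q * M + s] terms split into [q] full blocks, regrouped by residue, and fewer than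
    [M] leftover terms, whose sum is bounded through [K]. The average is the mean of those of the
    classes. *)
Lemma has_average_residue_classes a (M : nat) (K : R) : (0 < M)%N ->
  (forall n, `|a n| <= K) ->
  (forall r, (r < M)%N -> exists l, has_average (fun n => a (n * M + r)%N) l) ->
  exists l, has_average a l.
Proof.
move=> M0 aK ha.
have K0 : 0 <= K by apply: le_trans (normr_ge0 _) (aK 0%N).
have /choice[l hl] : forall r : 'I_M, exists l,
  has_average (fun n => a (n * M + r)%N) l by move=> r; exact: ha.
have M0' : 0 < M%:R :> R by rewrite ltr0n.
set L := (\sum_r l r) / M%:R.
exists L => e e0; have e2 : 0 < e / 2 by lra.
have /choice[N1 h1] := fun r => hl r _ e2.
have [N2 h2] := eventually_le_linear (M%:R * (K + `|L|)) e2.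
(* [N2] absorbs the incomplete block into [e / 2 * N%:R]; the other bound makes [q] at least every
   [N1 r]. *)
exists (maxn N2 (M * \max_r N1 r)) => N; rewrite geq_max => /andP[/h2 h3 hN].
set q := (N %/ M)%N; set s := (N %% M)%N.
have NE : N = (q * M + s)%N by exact: divn_eq.
have hq r : (N1 r <= q)%N.
  apply: (@leq_trans (\max_r N1 r)); first exact: leq_bigmax.
  by rewrite leq_divRL// mulnC.
have sM : s%:R <= M%:R :> R by rewrite ler_nat ltnW// ltn_mod.
have LE : L * N%:R = \sum_r (l r * q%:R) + L * s%:R.
  rewrite -mulr_suml {1}NE natrD natrM mulrDr; congr (_ + _).
  by rewrite /L; field; rewrite gt_eqF.
have -> : \sum_(i < N) a i = \sum_(i < q * M) a i + \sum_(i < s) a (q * M + i)%N.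
  by rewrite [in LHS]NE big_split_ord.
rewrite sum_residue_classes LE.
have -> : forall x y z t : R, x + y - (z + t) = (x - z) + (y - t).
  by move=> *; ring.
rewrite -sumrB; apply: le_trans (ler_normD _ _) _.
have b1 : `|\sum_(r < M) (\sum_(n < q) a (n * M + r)%N - l r * q%:R)| <=
    e / 2 * N%:R.
  apply: le_trans (ler_norm_sum _ _ _) _.
  apply: (@le_trans _ _ (\sum_(r < M) (e / 2 * q%:R))).
    by apply: ler_sum => r _; exact: h1.
  rewrite sumr_const card_ord -[leLHS]mulr_natr -[leLHS]mulrA.
  apply: ler_wpM2l; first lra.
  by rewrite -natrM ler_nat NE leq_addr.
have b2 : `|\sum_(i < s) a (q * M + i)%N - L * s%:R| <= M%:R * (K + `|L|).
  apply: le_trans (ler_normB _ _) _; rewrite mulrDr; apply: lerD; last first.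
    by rewrite normrM normr_nat mulrC; apply: ler_wpM2r.
  apply: le_trans (ler_norm_sum _ _ _) _.
  apply: (@le_trans _ _ (\sum_(r < s) K)); first exact: ler_sum.
  by rewrite sumr_const card_ord -[leLHS]mulr_natl; apply: ler_wpM2r.
lra.
Qed.

End Averages.

(** * Modulus and real part of complex numbers *)

Section ComplexNorm.
Variable R : rcfType.
Implicit Types x y z : R[i].

Lemma normc_ge0 x : 0 <= normc x.
Proof. by case: x => a b /=; exact: sqrtr_ge0. Qed.

Lemma normc_gt0 x : x != 0 -> 0 < normc x.
Proof.
move=> x0; rewrite lt_neqAle normc_ge0 andbT eq_sym.
by apply: contra x0 => /eqP/eq0_normc ->.
Qed.

Lemma normcX x n : normc (x ^+ n) = normc x ^+ n.
Proof. by elim: n => [|n IH]; rewrite ?normc1// !exprS normcM IH. Qed.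

Lemma normc_real (r : R) : normc r%:C = `|r|.
Proof. by rewrite /= expr0n addr0 sqrtr_sqr. Qed.

Lemma normc_conj x : normc x^* = normc x.
Proof. by case: x => a b /=; rewrite sqrrN. Qed.

Lemma Re_le_normc x : `|Re x| <= normc x.
Proof.
case: x => a b /=; rewrite -sqrtr_sqr; apply: ler_wsqrtr.
by rewrite lerDl sqr_ge0.
Qed.

Lemma le_normcB x y : normc (x - y) <= normc x + normc y.
Proof. by apply: le_trans (le_normcD _ _) _; rewrite normcN. Qed.

Lemma ReD x y : Re (x + y) = Re x + Re y.
Proof. by case: x y => [a b] [c d]. Qed.

Lemma Re_sum (I : Type) (s : seq I) (F : I -> R[i]) :
  Re (\sum_(i <- s) F i) = \sum_(i <- s) Re (F i).
Proof. by apply: (big_morph (@complex.Re R)) => // x y; exact: ReD. Qed.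

End ComplexNorm.

(** * Trigonometric sums and the averages of their absolute values *)

Section TrigonometricSequences.
Variable R : realType.
Implicit Types (f g : nat -> R[i]) (h : nat -> R).

(** As an inductive closure, with frequencies allowed to repeat, it is shown stable under products
    and conjugation by plain induction. *)
Inductive trig_seq : (nat -> R[i]) -> Prop :=
| trig_seq_mono (c u : R[i]) : normc u = 1 -> trig_seq (fun n => c * u ^+ n)
| trig_seqD f g : trig_seq f -> trig_seq g -> trig_seq (fun n => f n + g n).

Lemma trig_seq_ext f g : f =1 g -> trig_seq f -> trig_seq g.
Proof. by move=> /funext ->. Qed.

Lemma trig_seq_cst (c : R[i]) : trig_seq (fun=> c).
Proof.
apply: (trig_seq_ext _ (trig_seq_mono c (normc1 R))) => n.
by rewrite expr1n mulr1.
Qed.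

Lemma trig_seq_sum (I : Type) (s : seq I) (F : I -> nat -> R[i]) :
  (forall i, trig_seq (F i)) -> trig_seq (fun n => \sum_(i <- s) F i n).
Proof.
move=> hF; elim: s => [|i s IH].
  by apply: trig_seq_ext (trig_seq_cst 0) => n; rewrite big_nil.
by apply: trig_seq_ext (trig_seqD (hF i) IH) => n; rewrite big_cons.
Qed.

Lemma trig_seqM f g :
  trig_seq f -> trig_seq g -> trig_seq (fun n => f n * g n).
Proof.
move=> hf hg; elim: hf => [c u hu|f1 f2 _ h1 _ h2]; last first.
  by apply: (trig_seq_ext _ (trig_seqD h1 h2)) => n; rewrite mulrDl.
elim: hg => [d v hv|g1 g2 _ h1 _ h2]; last first.
  by apply: (trig_seq_ext _ (trig_seqD h1 h2)) => n; rewrite mulrDr.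
have uv : normc (u * v) = 1 by rewrite normcM hu hv mulr1.
apply: (trig_seq_ext _ (trig_seq_mono (c * d) uv)) => n.
by rewrite exprMn mulrACA.
Qed.

Lemma trig_seq_conj f : trig_seq f -> trig_seq (fun n => (f n)^*).
Proof.
elim=> [c u hu|f1 f2 _ h1 _ h2].
  have uc : normc u^* = 1 by rewrite normc_conj.
  apply: (trig_seq_ext _ (trig_seq_mono (c^*) uc)) => n.
  by rewrite rmorphM rmorphXn.
by apply: (trig_seq_ext _ (trig_seqD h1 h2)) => n; rewrite rmorphD.
Qed.

Lemma trig_seq_bounded f : trig_seq f -> exists K : R, forall n, normc (f n) <= K.
Proof.
elim=> [c u hu|f1 f2 _ [K1 h1] _ [K2 h2]].
  by exists (normc c) => n; rewrite normcM normcX hu expr1n mulr1.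
by exists (K1 + K2) => n; apply: le_trans (le_normcD _ _) (lerD (h1 n) (h2 n)).
Qed.

(** A frequency [u != 1] has average [0], because its geometric partial sums are bounded by
    [2 / normc (u - 1)]; the frequency [1] contributes a constant. *)
Lemma trig_seq_average f :
  trig_seq f -> exists l, has_average (fun n => Re (f n)) l.
Proof.
elim=> [c u hu|f1 f2 _ [l1 h1] _ [l2 h2]]; last first.
  exists (l1 + l2); apply: has_average_ext (has_averageD h1 h2) => n.
  by rewrite ReD.
have [->|u1] := eqVneq u 1.
  exists (Re c); apply: has_average_ext (has_average_cst (Re c)) => n.
  by rewrite expr1n mulr1.
have u1' : u - 1 != 0 by rewrite subr_eq0.
exists 0; apply: (@has_average_bounded_sum _ _ (normc c * (2 / normc (u - 1)))) => N.
rewrite -Re_sum; apply: le_trans (Re_le_normc _) _.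
rewrite -mulr_sumr normcM; apply: ler_wpM2l; first exact: normc_ge0.
rewrite ler_pdivlMr ?normc_gt0// -normcM mulrC -subrX1.
by apply: le_trans (le_normcB _ _) _; rewrite normcX hu expr1n normc1.
Qed.

Definition real_trig_seq h : Prop := trig_seq (fun n => (h n)%:C).

Lemma real_trig_seq_cst (c : R) : real_trig_seq (fun=> c).
Proof. exact: trig_seq_cst. Qed.

Lemma real_trig_seqD h k :
  real_trig_seq h -> real_trig_seq k -> real_trig_seq (fun n => h n + k n).
Proof.
by move=> hh hk; apply: trig_seq_ext (trig_seqD hh hk) => n; rewrite rmorphD.
Qed.

Lemma real_trig_seqM h k :
  real_trig_seq h -> real_trig_seq k -> real_trig_seq (fun n => h n * k n).
Proof.
by move=> hh hk; apply: trig_seq_ext (trig_seqM hh hk) => n; rewrite rmorphM.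
Qed.

Lemma real_trig_seq_Re f : trig_seq f -> real_trig_seq (fun n => Re (f n)).
Proof.
move=> hf; have := trig_seqM (trig_seq_cst 2^-1) (trig_seqD hf (trig_seq_conj hf)).
by apply: trig_seq_ext => n; rewrite ReJ_add mulrC.
Qed.

Lemma real_trig_seq_average h : real_trig_seq h -> exists l, has_average h l.
Proof. by move=> /trig_seq_average. Qed.

(* Newton-type iteration converging uniformly to [|t|] on [-1, 1]. *)
Fixpoint abs_approx (k : nat) (t : R) : R :=
  if k is k'.+1 then abs_approx k' t + (t ^+ 2 - abs_approx k' t ^+ 2) / 2 else 0.

(** One step turns the error [x = s - p], where [s] is the absolute value of [t], into
    [x * (1 - s + x / 2)]. As [x <= s], this is at most [x * (1 - x / 2)], and so a bound [2 / K]
    improves to [2 / (K + 1)]. *)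
Lemma abs_approxP k (t : R) : `|t| <= 1 ->
  0 <= `|t| - abs_approx k t <= 2 / k.+2%:R.
Proof.
move=> t1.
suff : 0 <= abs_approx k t <= `|t| /\ (`|t| - abs_approx k t) * k.+2%:R <= 2.
  move=> [/andP[h1 h2] h3]; rewrite subr_ge0 h2 /=.
  by rewrite ler_pdivlMr ?ltr0n.
elim: k => [|k [/andP[h1 h2] h3]].
  by rewrite /= subr0 lexx normr_ge0; split=> //; lra.
rewrite /= -(real_normK (num_real t)); set s := `|t| in t1 h2 h3 *.
have s0 : 0 <= s by exact: normr_ge0.
move: h1 h2 h3; set p := abs_approx k t => h1 h2 h3.
(* [b1] says that the iteration increases, [b2] that it does not overshoot [s]. *)
have b1 : 0 <= (s - p) * (s + p) by apply: mulr_ge0; lra.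
have b2 : 0 <= (s - p) * (2 - s - p) by apply: mulr_ge0; lra.
split; first by apply/andP; split; nra.
have -> : k.+3%:R = k.+2%:R + 1 :> R by rewrite natr1.
set K : R := k.+2%:R in h3 *.
have K2 : 2 <= K by rewrite ler_nat.
set x := s - p in h3 *.
have -> : s - (p + (s ^+ 2 - p ^+ 2) / 2) = x * (1 - s + x / 2) by rewrite /x; field.
have x0 : 0 <= x by rewrite /x; lra.
have x1 : x <= 1 by rewrite /x; lra.
have h4 : x * (1 - s + x / 2) <= x * (1 - x / 2).
  by apply: ler_wpM2l => //; rewrite /x; lra.
apply: (@le_trans _ _ (x * (1 - x / 2) * (K + 1))).
  by apply: ler_wpM2r => //; lra.
have q1 : 0 <= (2 - x * K) * (1 - x / 2) by apply: mulr_ge0; lra.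
nra.
Qed.

Lemma real_trig_seq_abs_approx k h :
  real_trig_seq h -> real_trig_seq (fun n => abs_approx k (h n)).
Proof.
move=> hh; elim: k => [|k IH]; first exact: real_trig_seq_cst.
have h1 := real_trig_seqM (real_trig_seq_cst (2^-1)) (real_trig_seqM hh hh).
have h2 := real_trig_seqM (real_trig_seq_cst (- 2^-1)) (real_trig_seqM IH IH).
apply: trig_seq_ext (real_trig_seqD IH (real_trig_seqD h1 h2)) => n /=.
by congr (_%:C); rewrite !expr2; field.
Qed.

(** Once [h] is rescaled into [[-1, 1]], its absolute value is a uniform limit of polynomials in
    [h], which are again trigonometric sums. *)
Lemma real_trig_seq_abs_average h :
  real_trig_seq h -> exists l, has_average (fun n => `|h n|) l.
Proof.
move=> hh; have [K hK] := trig_seq_bounded hh.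
have K0 : 0 <= K by apply: le_trans (hK 0%N); exact: normc_ge0.
have K1 : 0 < K + 1 by lra.
pose g n := (K + 1)^-1 * h n.
have hg : real_trig_seq g by apply: real_trig_seqM => //; exact: real_trig_seq_cst.
have g1 n : `|g n| <= 1.
  rewrite normrM gtr0_norm ?invr_gt0// mulrC ler_pdivrMr// mul1r -normc_real.
  by apply: le_trans (hK n) _; lra.
suff [l hl] : exists l, has_average (fun n => `|g n|) l.
  exists ((K + 1) * l); apply: has_average_ext (has_averageZ (K + 1) hl) => n.
  by rewrite normrM gtr0_norm ?invr_gt0// mulrA divff ?mul1r// gt_eqF.
apply: has_average_approx => e e0.
have [k hk] := eventually_le_linear 2 e0.
have [l hl] := real_trig_seq_average (real_trig_seq_abs_approx k hg).
exists (fun n => abs_approx k (g n)), l; split=> //.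
exists 0%N => N _; apply: (@le_trans _ _ (\sum_(i < N) e)).
  apply: ler_sum => i _; have /andP[h1 h2] := abs_approxP k (g1 i).
  rewrite ger0_norm//; apply: le_trans h2 _.
  by rewrite ler_pdivrMr ?ltr0n//; apply: hk; lia.
by rewrite sumr_const card_ord mulr_natr.
Qed.

End TrigonometricSequences.

(** * Density of the set where a trigonometric sum is small *)

Section RarelySmall.
Variable R : realType.
Implicit Types G : nat -> R[i].

Definition rarely_small G : Prop :=
  forall eta : R, 0 < eta -> exists k : R, 0 < k /\
    exists N0 : nat, forall N : nat, (N0 <= N)%N ->
      (\sum_(i < N) (normc (G i) <= k)%R)%:R <= eta * N%:R.

Lemma rarely_small_ext G H : G =1 H -> rarely_small G -> rarely_small H.
Proof. by move=> /funext ->. Qed.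

(** A counted point has no point of [S] among its [L] successors, so a window of length [L] contains
    at most one, and [N %/ L + 1] windows cover the range. *)
Lemma sum_isolated_le (S : pred nat) (L N : nat) : (0 < L)%N ->
  (\sum_(i < N) (S i && [forall d : 'I_L, ~~ S (i + d.+1)%N]) <= N %/ L + 1)%N.
Proof.
move=> L0; set I := fun i => S i && [forall d : 'I_L, ~~ S (i + d.+1)%N].
have window n : (\sum_(i < L) I (n + i) <= 1)%N.
  have -> : (\sum_(i < L) I (n + i) = #|[pred i : 'I_L | I (n + i)%N]|)%N.
    rewrite -sum1_card [RHS]big_mkcond; apply: eq_bigr => i _.
    by rewrite inE; case: (I _).
  have aux (i j : 'I_L) : I (n + i)%N -> I (n + j)%N -> ~ (i < j)%N.
    move=> /andP[_ /forallP hi] /andP[hj _] ij.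
    have dL : (j - i.+1 < L)%N by have := ltn_ord j; lia.
    have := hi (Ordinal dL); rewrite /=.
    have -> : (n + i + (j - i.+1).+1 = n + j)%N by lia.
    by rewrite hj.
  apply/card_le1_eqP => i j; rewrite !inE => hi hj.
  apply/val_inj => /=; have := aux _ _ hi hj; have := aux _ _ hj hi; lia.
have blocks q : (\sum_(i < q * L) I i <= q)%N.
  elim: q => [|q IH]; first by rewrite mul0n big_ord0.
  rewrite mulSn addnC big_split_ord /= -addn1.
  by apply: leq_add => //; exact: window.
apply: leq_trans (blocks _).
have [t ->] : exists t, ((N %/ L + 1) * L = N + t)%N.
  exists ((N %/ L + 1) * L - N)%N; rewrite subnKC//.
  by rewrite addn1 ltnW// ltn_ceil.
by rewrite big_split_ord leq_addr.
Qed.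

(* If [G] is small on a set of positive density, then two points of that set
   at a common bounded distance [d] occur with positive density, and
   [G (n + d) - w ^+ d * G n] is small there. *)
Lemma rarely_small_shift G (w : R[i]) : normc w = 1 ->
  (forall d, (0 < d)%N -> rarely_small (fun n => G (n + d)%N - w ^+ d * G n)) ->
  rarely_small G.
Proof.
move=> w1 hG eta eta0.
have [L0 hL0] := eventually_le_linear 4 eta0.
(* With [L >= 4 / eta], the isolated points number at most [eta / 4 * N%:R + 1]. *)
pose L := L0.+1; have hL : 4 <= eta * L%:R by apply: hL0; rewrite leqW.
have LR : 0 < L%:R :> R by rewrite ltr0n.
have eta'0 : 0 < eta / (2 * L%:R) by apply: divr_gt0 => //; lra.
have /choice[k hk] := fun d : 'I_L => hG d.+1 (ltn0Sn d) _ eta'0.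
have /choice[N1 hN1] := fun d : 'I_L => (hk d).2.
have k0 d : 0 < k d := (hk d).1.
(* The inverse of one plus the sum of the [(k d)^-1] is positive and below every [k d]. It is halved
   because two small values get added. *)
have [k1 [k10 hk1]] : exists k1 : R, 0 < k1 /\ forall d, k1 + k1 <= k d.
  exists ((\sum_d (k d)^-1 + 1)^-1 / 2); split.
    apply: divr_gt0 => //; rewrite invr_gt0; apply: ltr_wpDl => //.
    by apply: sumr_ge0 => d _; rewrite invr_ge0 ltW.
  move=> d; rewrite -splitr -[leRHS]invrK lef_pV2 ?posrE ?invr_gt0//.
    rewrite (bigD1 d)//= -addrA lerDl; apply: addr_ge0 => //.
    by apply: sumr_ge0 => i _; rewrite invr_ge0 ltW.
  apply: ltr_wpDl => //.
  by apply: sumr_ge0 => i _; rewrite invr_ge0 ltW.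
(* This absorbs the [+ 1] of the isolated points into [eta / 4 * N%:R]. *)
have [N2 hN2] := eventually_le_linear 4 eta0.
exists k1; split=> //; exists (maxn N2 (\max_d N1 d)) => N.
rewrite geq_max => /andP[/hN2 b1 hN].
pose S i := normc (G i) <= k1.
pose T (d : 'I_L) i := normc (G (i + d.+1)%N - w ^+ d.+1 * G i) <= k d.
(* A point of [S] is either isolated or followed by another one at distance [d.+1]; then the
   triangle inequality gives [T d i]. *)
have bnd i : (S i <= (S i && [forall d : 'I_L, ~~ S (i + d.+1)%N]) +
    \sum_(d < L) T d i)%N.
  case Si : (S i) => //=; case: forallP => //= /forallP.
  rewrite negb_forall => /existsP[d]; rewrite negbK => Sid.
  rewrite (bigD1 d)//=; suff -> : T d i by [].
  rewrite /T; apply: le_trans (hk1 d).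
  apply: le_trans (le_normcB _ _) (lerD Sid _).
  by rewrite normcM normcX w1 expr1n mul1r.
have b2 : (\sum_(i < N) S i <= (N %/ L + 1) + \sum_(d < L) \sum_(i < N) T d i)%N.
  apply: (leq_trans (leq_sum _ _)) => [i _|]; first exact: (bnd i).
  rewrite big_split /= [X in (_ + X <= _)%N]exchange_big /= leq_add2r.
  exact: sum_isolated_le.
apply: le_trans (_ : ((N %/ L + 1) + \sum_(d < L) \sum_(i < N) T d i)%N%:R <= _).
  by rewrite ler_nat.
rewrite natrD natr_sum natrD.
have b3 : \sum_(d < L) (\sum_(i < N) T d i)%N%:R <= eta / 2 * N%:R.
  apply: (@le_trans _ _ (\sum_(d < L) (eta / (2 * L%:R) * N%:R))).
    apply: ler_sum => d _; apply: hN1; apply: leq_trans hN.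
    exact: leq_bigmax.
  rewrite sumr_const card_ord -[leLHS]mulr_natr le_eqVlt; apply/orP; left.
  by apply/eqP; field; rewrite gt_eqF.
have b4 : (N %/ L)%:R <= eta / 4 * N%:R.
  have : (N %/ L)%:R * L%:R <= N%:R :> R by rewrite -natrM ler_nat leq_trunc_div.
  move=> b4; rewrite -(ler_pM2r LR); apply: le_trans b4 _.
  have : 4 * N%:R <= eta * L%:R * N%:R by apply: ler_wpM2r.
  nra.
lra.
Qed.

(** Passing to [G (n + d) - w ^+ d * G n] multiplies each coefficient [c u] by [u ^+ d - w ^+ d].
    This removes [w] and keeps the coefficient of [u0] nonzero, so the induction ends with a single
    term of constant positive modulus. *)
Lemma rarely_small_trig (u0 : R[i]) (s : seq R[i]) (c : R[i] -> R[i]) :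
  normc u0 = 1 -> c u0 != 0 ->
  (forall w, w \in s -> normc w = 1 /\
     forall d, (0 < d)%N -> u0 ^+ d != w ^+ d) ->
  rarely_small (fun n => \sum_(u <- u0 :: s) c u * u ^+ n).
Proof.
move=> u01; elim: s c => [|w s IH] c c0 hs.
  move=> eta eta0; exists (normc (c u0) / 2); split.
    by apply: divr_gt0 => //; exact: normc_gt0.
  exists 0%N => N _; rewrite big1 ?mulr_ge0 ?ler0n// ?ltW// => i _.
  rewrite big_seq1 normcM normcX u01 expr1n mulr1.
  have := normc_gt0 c0; set x := normc _ => x0.
  by have /negbTE -> : ~~ (x <= x / 2) by rewrite -ltNge; lra.
have [w1 hw] : normc w = 1 /\ forall d, (0 < d)%N -> u0 ^+ d != w ^+ d.
  by apply: hs; rewrite mem_head.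
apply: (rarely_small_shift w1) => d d0.
have := IH (fun u => c u * (u ^+ d - w ^+ d)).
rewrite mulf_eq0 negb_or c0 subr_eq0 hw// => /(_ isT).
have hs' w' : w' \in s -> normc w' = 1 /\
   forall d, (0 < d)%N -> u0 ^+ d != w' ^+ d.
  by move=> w's; apply: hs; rewrite inE w's orbT.
move=> /(_ hs'); apply: rarely_small_ext => n.
have -> : \sum_(u <- u0 :: s) c u * (u ^+ d - w ^+ d) * u ^+ n =
    \sum_(u <- u0 :: s) c u * u ^+ (n + d) -
    w ^+ d * \sum_(u <- u0 :: s) c u * u ^+ n.
  by rewrite mulr_sumr -sumrB; apply: eq_bigr => u _; rewrite exprD; ring.
by rewrite !big_cons !exprD; ring.
Qed.

End RarelySmall.

(** * Recurrences as exponential polynomials, and residue classes *)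

Section ClosedForm.
Variable R : realType.
Local Notation C := R[i].
Implicit Types (f g : nat -> C) (z beta : C) (p : {poly C}).

(** Binomials replace powers of [n] because Pascal's rule makes [h n.+1 - z * h n] explicit on them.
    The condition [beta != 0] allows division by [beta]; a zero root affects finitely many terms
    only. *)
Inductive binomial_exponential : (nat -> C) -> Prop :=
| binexp0 : binomial_exponential (fun=> 0)
| binexp_cons (c beta : C) (j : nat) g : beta != 0 -> binomial_exponential g ->
    binomial_exponential (fun n => c * ('C(n, j)%:R * beta ^+ n) + g n).

Lemma binexp_ext f g :
  f =1 g -> binomial_exponential f -> binomial_exponential g.
Proof. by move=> /funext ->. Qed.

Lemma binexp_mono (c beta : C) (j : nat) : beta != 0 ->
  binomial_exponential (fun n => c * ('C(n, j)%:R * beta ^+ n)).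
Proof.
move=> b0; apply: binexp_ext (binexp_cons c j b0 binexp0) => n.
by rewrite addr0.
Qed.

Lemma binexpD f g : binomial_exponential f -> binomial_exponential g ->
  binomial_exponential (fun n => f n + g n).
Proof.
move=> hf hg; elim: hf => [|c beta j f' b0 _ IH].
  by apply: binexp_ext hg => n; rewrite add0r.
by apply: binexp_ext (binexp_cons c j b0 IH) => n; rewrite addrA.
Qed.

Lemma binexpZ (c : C) f : binomial_exponential f ->
  binomial_exponential (fun n => c * f n).
Proof.
elim => [|d beta j f' b0 _ IH].
  by apply: binexp_ext binexp0 => n; rewrite mulr0.
apply: binexp_ext (binexp_cons (c * d) j b0 IH) => n.
by rewrite mulrDr !mulrA.
Qed.

(** If [z = beta], raising [j] by one solves the equation. Otherwise the operator maps
    ['C(n, j.+1) beta ^+ n] to [beta - z] times itself plus a term of index [j], which the induction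
    hypothesis corrects. *)
Lemma binexp_solve_mono z beta j : beta != 0 ->
  exists h, binomial_exponential h /\
    forall n, h n.+1 - z * h n = 'C(n, j)%:R * beta ^+ n.
Proof.
move=> b0; have [->|bz] := eqVneq z beta.
  exists (fun n => beta^-1 * ('C(n, j.+1)%:R * beta ^+ n)); split.
    exact: binexp_mono.
  by move=> n; rewrite binS natrD exprS; field.
have bz0 : beta - z != 0 by rewrite subr_eq0 eq_sym.
elim: j => [|j [h0 [hh0 IH]]].
  exists (fun n => (beta - z)^-1 * ('C(n, 0)%:R * beta ^+ n)); split.
    exact: binexp_mono.
  by move=> n; rewrite !bin0 exprS; field.
exists (fun n => (beta - z)^-1 * ('C(n, j.+1)%:R * beta ^+ n)
                 + - (beta / (beta - z)) * h0 n); split.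
  by apply: binexpD; [exact: binexp_mono | exact: binexpZ].
move=> n; have {}IH : h0 n.+1 = 'C(n, j)%:R * beta ^+ n + z * h0 n.
  by rewrite -IH subrK.
by rewrite IH binS natrD exprS; field.
Qed.

Lemma binexp_solve z g : binomial_exponential g ->
  exists h, binomial_exponential h /\ forall n, h n.+1 - z * h n = g n.
Proof.
elim => [|c beta j f b0 _ [h [hh IH]]].
  exists (fun=> 0); split=> [|n]; first exact: binexp0.
  by rewrite mulr0 subrr.
have [k [hk Hk]] := binexp_solve_mono z j b0.
exists (fun n => c * k n + h n); split.
  by apply: binexpD => //; exact: binexpZ.
by move=> n; rewrite -Hk -IH; ring.
Qed.

Definition eventually_binexp f : Prop :=
  exists g, binomial_exponential g /\
    exists N0 : nat, forall n, (N0 <= n)%N -> f n = g n.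

Lemma eventually_binexp_integrate z f :
  eventually_binexp (fun n => f n.+1 - z * f n) -> eventually_binexp f.
Proof.
move=> [g [/(binexp_solve z)[h [hh Hh]] [N0 H0]]].
(* For [z = 0] the hypothesis says that [f] and [h] agree from [N0.+1] on; this is where initial
   terms get lost. *)
have [z0|z0] := eqVneq z 0.
  exists h; split=> //; exists N0.+1 => -[//|n] /H0.
  by rewrite -Hh z0 !mul0r !subr0.
(* Past [N0] the difference [f - h] is geometric of ratio [z], hence determined by its value at
   [N0]. *)
exists (fun n => (f N0 - h N0) / z ^+ N0 * ('C(n, 0)%:R * z ^+ n) + h n); split.
  by apply: binexpD => //; exact: binexp_mono.
exists N0 => n hn; apply/eqP; rewrite -subr_eq; apply/eqP.
have zN : z ^+ N0 != 0 by rewrite expf_neq0.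
rewrite -(subnKC hn) bin0 mul1r exprD mulrA divfK//.
elim: (n - N0)%N => [|m IH]; first by rewrite addn0 expr0 mulr1.
have := H0 (N0 + m)%N (leq_addr _ _); rewrite -Hh addnS exprS => H.
by rewrite mulrCA -IH; apply/eqP; rewrite -subr_eq0; move/eqP: H;
   rewrite -subr_eq0 => /eqP <-; apply/eqP; ring.
Qed.

(* The action of [p] evaluated at the shift operator. *)
Definition shift_poly f (p : {poly C}) (n : nat) : C :=
  \sum_(i < size p) p`_i * f (n + i)%N.

Lemma shift_poly_widen f p n N : (size p <= N)%N ->
  shift_poly f p n = \sum_(i < N) p`_i * f (n + i)%N.
Proof.
move=> pN; rewrite /shift_poly (big_ord_widen N (fun i => p`_i * f (n + i)%N) pN).
rewrite big_mkcond; apply: eq_bigr => i _; case: ltnP => // hi.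
by rewrite nth_default// mul0r.
Qed.

Lemma shift_polyZ f (a : C) p n :
  shift_poly f (a *: p) n = a * shift_poly f p n.
Proof.
rewrite (shift_poly_widen _ _ (size_scale_leq a p)) /shift_poly mulr_sumr.
by apply: eq_bigr => i _; rewrite coefZ mulrA.
Qed.

Lemma shift_poly_mulXsubC f z p n :
  shift_poly f (p * ('X - z%:P)) n =
  shift_poly (fun n => f n.+1 - z * f n) p n.
Proof.
have sz : (size (p * ('X - z%:P))%R <= (size p).+1)%N.
  by apply: leq_trans (size_polyMleq _ _) _; rewrite size_XsubC addn2.
rewrite (shift_poly_widen _ _ sz) /shift_poly.
under eq_bigr do rewrite mulrBr coefB coefMX coefMC mulrBl.
rewrite sumrB big_ord_recl /= mul0r add0r big_ord_recr /=.
rewrite nth_default// mul0r mul0r addr0 -sumrB.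
by apply: eq_bigr => i _; rewrite /bump /= add1n addnS; ring.
Qed.

(** The linear factors are peeled off one at a time, each being a first-order equation to
    integrate. *)
Lemma eventually_binexp_roots (r : seq C) f :
  (forall n, shift_poly f (\prod_(z <- r) ('X - z%:P)) n = 0) ->
  eventually_binexp f.
Proof.
elim: r f => [|z r IH] f H.
  exists (fun=> 0); split; first exact: binexp0.
  exists 0%N => n _; have := H n.
  by rewrite big_nil /shift_poly size_poly1 big_ord1 coef1 mul1r addn0.
apply: (@eventually_binexp_integrate z); apply: IH => n.
by rewrite -shift_poly_mulXsubC mulrC -(H n) big_cons.
Qed.

Lemma recurrence_eventually_binexp (f : nat -> R) :
  recurrence_sequence f -> eventually_binexp (fun n => (f n)%:C).
Proof.
move=> [h [h1 [c hc]]].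
(* [p] is the characteristic polynomial: ['X^i] stands for [f (n + i)], which carries the constant
   of index [h - i]. *)
pose q : {poly C} := \poly_(i < h) (c (h - i)%N)%:C.
pose p : {poly C} := 'X^h - q.
have sp : size p = h.+1.
  by rewrite size_polyDl size_polyXn// size_polyN ltnS size_poly.
have p0 : lead_coef p != 0 by rewrite lead_coef_eq0 -size_poly_eq0 sp.
have [r pr] := closed_field_poly_normal p.
apply: (@eventually_binexp_roots r) => n.
apply: (mulfI p0); rewrite mulr0 -shift_polyZ -pr /shift_poly sp.
rewrite big_ord_recr /= coefB coefXn eqxx coef_poly ltnn subr0 mul1r hc.
rewrite rmorph_sum big_add1 big_mkord /=.
apply/eqP; rewrite addrC addr_eq0 -sumrN; apply/eqP.
rewrite [LHS](reindex_inj rev_ord_inj) /=.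
apply: eq_bigr => i _; have hi := ltn_ord i.
rewrite coefB coefXn coef_poly hi (ltn_eqF hi) sub0r mulNr opprK -rmorphM.
by congr (_%:C); congr (c _ * f _); lia.
Qed.

Lemma binomial_polynomial (j : nat) :
  exists P : {poly C}, forall n : nat, P.[n%:R] = 'C(n, j)%:R.
Proof.
elim: j => [|j [P hP]].
  by exists 1 => n; rewrite hornerC bin0.
exists (j.+1%:R^-1 *: (P * ('X - j%:R%:P))) => n.
have j0 : j.+1%:R != 0 :> C by rewrite pnatr_eq0.
rewrite hornerZ hornerM hornerXsubC hP; apply: (mulfI j0).
rewrite mulrA divff// mul1r -natrM mul_bin_left.
(* For [n < j] the natural subtraction truncates, but then ['C(n, j)] vanishes on both sides. *)
have [jn|nj] := leqP j n; first by rewrite natrM natrB// mulrC.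
by rewrite bin_small// muln0 mul0r.
Qed.

Lemma binexp_polynomial_form f : binomial_exponential f ->
  exists s : seq (C * {poly C}), (forall x, x \in s -> x.1 != 0) /\
    forall n, f n = \sum_(x <- s) x.2.[n%:R] * x.1 ^+ n.
Proof.
elim=> [|c beta j g b0 _ [s [s0 hs]]].
  by exists [::]; split=> // n; rewrite big_nil.
have [P hP] := binomial_polynomial j.
exists ((beta, c *: P) :: s); split.
  by move=> x; rewrite inE => /orP[/eqP ->//|/s0].
by move=> n; rewrite big_cons /= hornerZ hP hs !mulrA.
Qed.

(** An equality [a ^+ d = b ^+ d] persists for multiples of [d], so the product of one exponent per
    pair serves all pairs. *)
Lemma common_period (A : seq C) : exists M : nat, (0 < M)%N /\
  forall a b, a \in A -> b \in A ->
    (exists d, (0 < d)%N /\ a ^+ d = b ^+ d) -> a ^+ M = b ^+ M.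
Proof.
have /choice[e he] : forall p : C * C, exists d, (0 < d)%N /\
    ((exists d', (0 < d')%N /\ p.1 ^+ d' = p.2 ^+ d') -> p.1 ^+ d = p.2 ^+ d).
  move=> p; case: (pselect (exists d', (0 < d')%N /\ p.1 ^+ d' = p.2 ^+ d')).
    by move=> [d [d0 hd]]; exists d.
  (* A pair without such an exponent gets the default [1], which keeps the product positive. *)
  by move=> np; exists 1%N.
exists (\prod_(a <- A) \prod_(b <- A) e (a, b))%N; split.
  by apply: prodn_gt0 => a; apply: prodn_gt0 => b; case: (he (a, b)).
move=> a b aA bA hd; have [_ /(_ hd)/= hab] := he (a, b).
rewrite (big_rem a aA) /= (big_rem b bA) /=.
by rewrite -!mulnA !exprM hab.
Qed.

(** On a class the base [x.1] becomes [x.1 ^+ M], and terms with equal new bases are merged. If two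
    new bases have a common power, so do the old ones, and the choice of [M] makes the new bases
    equal. *)
Lemma residue_class_form f (s : seq (C * {poly C})) :
  (forall x, x \in s -> x.1 != 0) ->
  (forall n, f n = \sum_(x <- s) x.2.[n%:R] * x.1 ^+ n) ->
  exists M : nat, (0 < M)%N /\ forall r : nat,
    exists (B : seq C) (Q : C -> {poly C}),
      [/\ uniq B, (forall b, b \in B -> b != 0),
       (forall b b', b \in B -> b' \in B -> b != b' ->
          forall d, (0 < d)%N -> b ^+ d != b' ^+ d) &
       (forall n, f (n * M + r)%N = \sum_(b <- B) (Q b).[n%:R] * b ^+ n)].
Proof.
move=> s0 hf; have [M [M0 hM]] := common_period (map fst s).
exists M; split=> // r.
pose key (x : C * {poly C}) := x.1 ^+ M.
(* The factor [x.1 ^+ r] of [x.1 ^+ (n * M + r)] does not depend on [n] and joins the coefficient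
   polynomial. *)
pose P (x : C * {poly C}) := x.1 ^+ r *: (x.2 \Po (M%:R *: 'X + r%:R%:P)).
exists (undup (map key s)), (fun b => \sum_(x <- s | key x == b) P x); split.
- exact: undup_uniq.
- move=> b; rewrite mem_undup => /mapP[x xs ->].
  by rewrite expf_neq0// s0.
- move=> b b'; rewrite !mem_undup => /mapP[x xs ->] /mapP[y ys ->] xy d d0.
  apply: contra xy => /eqP; rewrite /key -!exprM => xy.
  apply/eqP/hM; rewrite ?map_f//; exists (M * d)%N.
  by rewrite muln_gt0 M0.
- move=> n; rewrite hf.
  under [RHS]eq_bigr do rewrite horner_sum mulr_suml big_mkcond /=.
  rewrite exchange_big /=; apply: eq_big_seq => x xs.
  have kx : key x \in undup (map key s) by rewrite mem_undup map_f.
  rewrite (bigD1_seq (key x))//= ?undup_uniq// eqxx big1 ?addr0; last first.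
    by move=> b; rewrite eq_sym => /negbTE ->.
  rewrite /P hornerZ horner_comp hornerD hornerZ hornerX hornerC -natrM -natrD.
  by rewrite (mulnC M) /key -exprM (mulnC M) exprD; ring.
Qed.

End ClosedForm.

(** * Isolating the dominant term and averaging the sign *)

Section DominantTerm.
Variable R : realType.
Local Notation C := R[i].
Implicit Types (a : nat -> C) (f : nat -> R).

(** [n%:R * y ^+ n] is at most the geometric sum of the [y ^+ i] for [i < n]. *)
Lemma linear_geometric_bounded (y : R) : 0 <= y < 1 ->
  forall n, n%:R * y ^+ n <= (1 - y)^-1.
Proof.
move=> /andP[y0 y1] n; have y1' : 0 < 1 - y by lra.
rewrite -[leRHS]mul1r ler_pdivlMr//.
have -> : n%:R * y ^+ n * (1 - y) = (1 - y) * \sum_(i < n) y ^+ n.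
  by rewrite sumr_const card_ord -[y ^+ n *+ n]mulr_natl mulrC.
apply: (@le_trans _ _ ((1 - y) * \sum_(i < n) y ^+ i)).
  apply: ler_wpM2l; first lra.
  by apply: ler_sum => i _; apply: ler_wiXn2l => //; [lra | exact: ltnW].
rewrite -opprB mulNr -subrX1 opprB lerBlDr lerDl.
exact: exprn_ge0.
Qed.

(** With [x = y * y], one factor [n%:R] is paired with [y ^+ n] and the rest falls under the
    induction hypothesis for [y]. *)
Lemma power_geometric_bounded (k : nat) (x : R) : 0 <= x < 1 ->
  exists K : R, forall n, n%:R ^+ k * x ^+ n <= K.
Proof.
elim: k x => [|k IH] x /andP[x0 x1].
  by exists 1 => n; rewrite mul1r; apply: exprn_ile1 => //; lra.
set y := Num.sqrt x.
have yx : x = y * y by rewrite -expr2 sqr_sqrtr.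
have y01 : 0 <= y < 1.
  by rewrite sqrtr_ge0 -[ltRHS]sqrtr1 ltr_sqrt.
have /andP[y0 _] := y01.
have [K hK] := IH _ y01.
exists ((1 - y)^-1 * K) => n.
have -> : n%:R ^+ k.+1 * x ^+ n = (n%:R * y ^+ n) * (n%:R ^+ k * y ^+ n).
  by rewrite yx exprMn exprS; ring.
apply: ler_pM; rewrite ?mulr_ge0 ?exprn_ge0 ?ler0n//.
exact: linear_geometric_bounded.
Qed.

(** This is [O(1/n)] rather than [o(1)]: an explicit rate that all the error terms satisfy. *)
Definition decays a : Prop := exists (K : R) (N0 : nat),
  forall n, (N0 <= n)%N -> normc (a n) * n%:R <= K.

Lemma decaysD a a' :
  decays a -> decays a' -> decays (fun n => a n + a' n).
Proof.
move=> [K [N0 hK]] [K' [N0' hK']]; exists (K + K'), (maxn N0 N0') => n.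
rewrite geq_max => /andP[/hK h /hK' h'].
apply: le_trans (lerD h h'); rewrite -mulrDl.
by apply: ler_wpM2r; [exact: ler0n | exact: le_normcD].
Qed.

Lemma decays_sum (I : eqType) (s : seq I) (F : I -> nat -> C) :
  (forall i, i \in s -> decays (F i)) -> decays (fun n => \sum_(i <- s) F i n).
Proof.
elim: s => [|i s IH] hF.
  by exists 0, 0%N => n _; rewrite big_nil normc0 mul0r.
have h1 : decays (F i) by apply: hF; rewrite mem_head.
have h2 : decays (fun n => \sum_(i <- s) F i n).
  by apply: IH => j js; apply: hF; rewrite inE js orbT.
have [K [N0 hK]] := decaysD h1 h2; exists K, N0 => n /hK.
by rewrite big_cons.
Qed.

Lemma decays_ext a a' (N0 : nat) :
  (forall n, (N0 <= n)%N -> a n = a' n) -> decays a -> decays a'.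
Proof.
move=> aa' [K [N1 hK]]; exists K, (maxn N0 N1) => n.
by rewrite geq_max => /andP[h0 /hK]; rewrite aa'.
Qed.

(** Either the geometric factor beats every power of [n], or [j < D] leaves a factor [1/n] to
    spare. *)
Lemma decays_monomial (q v : C) (j D : nat) :
  normc v < 1 \/ normc v = 1 /\ (j < D)%N ->
  decays (fun n => q * n%:R ^+ j * v ^+ n / n%:R ^+ D).
Proof.
move=> hv.
have normn n : normc (n%:R : C) = n%:R.
  by rewrite -(rmorph_nat (real_complex R)) normc_real normr_nat.
have normE n : normc (q * n%:R ^+ j * v ^+ n / n%:R ^+ D) * n%:R =
    normc q * (n%:R ^+ j.+1 * normc v ^+ n / n%:R ^+ D).
  by rewrite !normcM normcV !normcX !normn exprS; ring.
case: hv => [v1|[v1 jD]].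
  have [K hK] : exists K : R, forall n, n%:R ^+ j.+1 * normc v ^+ n <= K.
    by apply: power_geometric_bounded; rewrite normc_ge0.
  exists (normc q * K), 1%N => n n0; rewrite normE.
  apply: ler_wpM2l; first exact: normc_ge0.
  have nD : 1 <= n%:R ^+ D :> R by rewrite exprn_ege1// ler1n.
  rewrite ler_pdivrMr; last by lra.
  apply: le_trans (hK n) _; apply: ler_peMr => //.
  by apply: le_trans (hK n); rewrite mulr_ge0 ?exprn_ge0 ?ler0n ?normc_ge0.
exists (normc q), 1%N => n n0; rewrite normE v1 expr1n mulr1.
apply: ler_piMr; first exact: normc_ge0.
rewrite ler_pdivrMr ?exprn_gt0 ?ltr0n// mul1r.
by apply: ler_weXn2l => //; rewrite ler1n.
Qed.

Lemma sum_ltn_le (N m : nat) : (\sum_(i < N) (i < m) <= m)%N.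
Proof.
have -> : (\sum_(i < N) (i < m) = minn N m)%N; last exact: geq_minr.
elim: N => [|N IH]; first by rewrite big_ord0 min0n.
by rewrite big_ord_recr /= IH; lia.
Qed.

(** The weight [w] normalizes [f] without changing its sign. As [f n * w n] is real and close to
    [G n], a [G n] of modulus above [k] has a real part away from [0] and of the sign of [f n]. *)
Lemma positivity_average f (G : nat -> C) (w : nat -> R) (N0 : nat) :
  (forall n, (N0 <= n)%N -> 0 < w n) -> trig_seq G -> rarely_small G ->
  decays (fun n => (f n * w n)%:C - G n) ->
  exists l, has_average (fun n => (0 < f n)%R%:R : R) l.
Proof.
move=> w0 tG sG [K [N1 hK]]; apply: has_average_approx => eta eta0.
have eta2 : 0 < eta / 2 by lra.
have [k [k0 [N2 hN2]]] := sG _ eta2.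
(* A third of [k] is lost from [G n] to [F], another from [F] to [h n], so that [h n] stays beyond
   [e] in absolute value. *)
pose e := k / 3; have e0 : 0 < e by rewrite /e; lra.
pose h n := Re (G n).
have th : real_trig_seq h by exact: real_trig_seq_Re.
(* The ramp equal to [0] for [h n <= - e], to [1] for [h n >= e], and linear between, written with
   absolute values whose averages are known. *)
pose phi n := 1 / 2 + (4 * e)^-1 * (`|h n + e| + -1 * `|h n - e|).
have [l1 a1] := real_trig_seq_abs_average
  (real_trig_seqD th (real_trig_seq_cst e)).
have [l2 a2] := real_trig_seq_abs_average
  (real_trig_seqD th (real_trig_seq_cst (- e))).
exists phi; eexists; split.
  apply: has_averageD (has_average_cst _) _.
  exact: has_averageZ (has_averageD a1 (has_averageZ (-1) a2)).
have [N3 hN3] := eventually_le_linear K e0.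
pose N4 := maxn (maxn N0 N1) (maxn N3 1).
have phi01 n : 0 <= phi n <= 1.
  have -> : phi n = (2 * e + `|h n + e| - `|h n - e|) / (4 * e).
    by rewrite /phi; field; rewrite gt_eqF.
  have e4 : 0 < 4 * e by lra.
  rewrite ler_pdivlMr// ler_pdivrMr// mul0r mul1r.
  have := ler_normD (h n - e) (2 * e); have := ler_normB (h n + e) (2 * e).
  have -> : `|2 * e| = 2 * e by apply: gtr0_norm; lra.
  have -> : h n - e + 2 * e = h n + e by ring.
  have -> : h n + e - 2 * e = h n - e by ring.
  by move=> *; apply/andP; split; lra.
have bnd n : `|(0 < f n)%R%:R - phi n| <=
    ((n < N4)%N + (normc (G n) <= k)%R)%N%:R.
  have triv : `|(0 < f n)%R%:R - phi n| <= 1.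
    have /andP[p0 p1] := phi01 n.
    by rewrite ler_norml; case: (0 < f n)%R => /=; apply/andP; split; lra.
  case: ltnP => [_|]; first by apply: le_trans triv _; rewrite ler1n.
  case: (leP (normc (G n)) k) => [_ _|Gk]; first by apply: le_trans triv _.
  rewrite !geq_max => /andP[/andP[/w0 wn /hK hKn] /andP[/hN3 hen n1]].
  have nR : 0 < n%:R :> R by rewrite ltr0n.
  have hFG : normc ((f n * w n)%:C - G n) <= e.
    by rewrite -(ler_pM2r nR); apply: le_trans hKn hen.
  set F := f n * w n in hFG.
  have Fh : `|F - h n| <= e.
    apply: le_trans hFG; apply: le_trans (Re_le_normc _).
    by rewrite /h; case: (G n).
  have Fk : 2 * e < `|F|.
    rewrite -normc_real.
    have := le_normcB F%:C (F%:C - G n); rewrite opprB addrCA subrr addr0.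
    by rewrite /e in hFG *; lra.
  have fF : (0 < f n) = (0 < F) by rewrite /F pmulr_lgt0.
  rewrite fF /= addn0; suff -> : phi n = (0 < F)%R%:R by rewrite subrr normr0.
  rewrite /phi; move: Fh; rewrite ler_norml => /andP[Fh1 Fh2].
  case: (ltP 0 F) Fk => F0.
    rewrite (gtr0_norm F0) => Fk.
    rewrite !ger0_norm; [|lra..].
    by rewrite /=; field; rewrite gt_eqF.
  rewrite (ler0_norm F0) => Fk.
  rewrite !ler0_norm; [|lra..].
  by rewrite /=; field; rewrite gt_eqF.
have [N5 hN5] := eventually_le_linear N4%:R eta2.
exists (maxn N2 N5) => N; rewrite geq_max => /andP[/hN2 b1 /hN5 b2].
apply: le_trans (ler_sum _ (fun (i : 'I_N) _ => bnd i)) _.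
rewrite -natr_sum big_split /= natrD.
have : (\sum_(i < N) (i < N4))%N%:R <= N4%:R :> R.
  by rewrite ler_nat; exact: sum_ltn_le.
lra.
Qed.

Lemma seq_maximum (T : eqType) (d : Order.disp_t) (O : orderType d)
    (F : T -> O) (s : seq T) : s != [::] ->
  exists2 x, x \in s & forall y, y \in s -> (F y <= F x)%O.
Proof.
elim: s => [//|x s IH] _; have [->|/IH[y ys hy]] := eqVneq s [::].
  by exists x; rewrite ?mem_head// => y; rewrite inE => /eqP ->.
have [xy|yx] := leP (F x) (F y).
  exists y; first by rewrite inE ys orbT.
  by move=> z; rewrite inE => /orP[/eqP ->//|/hy].
exists x; first by rewrite mem_head.
move=> z; rewrite inE => /orP[/eqP ->//|/hy zy].
exact: le_trans zy (ltW yx).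
Qed.

(** The dominant growth is [n%:R ^+ D * rho ^+ n], with [rho] the largest modulus and [D] the
    largest degree at that modulus. Dividing by it leaves the sum [G] of the degree [D] coefficients
    against the unit frequencies [b / rho%:C]. *)
Lemma nondegenerate_positivity_average f (B : seq C) (Q : C -> {poly C})
    (N0 : nat) :
  uniq B -> (forall b, b \in B -> b != 0) ->
  (forall b b', b \in B -> b' \in B -> b != b' ->
     forall d, (0 < d)%N -> b ^+ d != b' ^+ d) ->
  (forall n, (N0 <= n)%N ->
     (f n)%:C = \sum_(b <- B) (Q b).[n%:R] * b ^+ n) ->
  exists l, has_average (fun n => (0 < f n)%R%:R : R) l.
Proof.
move=> uB B0 ndB hf.
(* Zero polynomials are discarded so that [rho] and [D] come from terms really present. *)
pose B1 := [seq b <- B | Q b != 0].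
have hf1 n : (N0 <= n)%N -> (f n)%:C = \sum_(b <- B1) (Q b).[n%:R] * b ^+ n.
  move=> /hf ->; rewrite big_filter [RHS]big_mkcond; apply: eq_bigr => b _.
  by have [->|//] := eqVneq (Q b) 0; rewrite horner0 mul0r.
have [B1n|B1n] := eqVneq B1 [::].
  exists 0; apply: (@has_average_bounded_sum _ _ N0%:R) => N.
  rewrite -natr_sum normr_nat ler_nat.
  apply: (@leq_trans (\sum_(i < N) (i < N0))).
    apply: leq_sum => i _; case: ltnP => [_|/hf1]; first by case: (0 < f i)%R.
    by rewrite B1n big_nil => /complexI ->; rewrite ltxx.
  exact: sum_ltn_le.
have [b1 b1B hb1] := seq_maximum (@normc R) B1n.
pose B2 := [seq b <- B1 | normc b == normc b1].
have B2n : B2 != [::].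
  have : b1 \in B2 by rewrite mem_filter eqxx.
  by case: B2.
have [b0 b0B hb0] := seq_maximum (fun b => size (Q b)) B2n.
move: (b0B); rewrite mem_filter => /andP[/eqP nb0 b0B1].
have B1B b : b \in B1 -> b \in B /\ Q b != 0.
  by rewrite mem_filter => /andP[? ?].
pose rho := normc b0; pose D := (size (Q b0)).-1.
have rho0 : 0 < rho by apply/normc_gt0/B0; case: (B1B _ b0B1).
have rhoC : rho%:C != 0.
  by rewrite -(rmorph0 (real_complex R)) (inj_eq (@complexI R)) gt_eqF.
have nrm b : normc (b / rho%:C) = normc b / rho.
  by rewrite normcM normcV normc_real gtr0_norm.
(* Coefficients must be a function of the frequency [u]; the base is recovered as [u * rho%:C]. *)
pose c (u : C) := (Q (u * rho%:C))`_D.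
pose s := map (fun b => b / rho%:C) (rem b0 B2).
pose G n := \sum_(u <- (b0 / rho%:C) :: s) c u * u ^+ n.
have GE n : G n = \sum_(b <- B2) (Q b)`_D * (b / rho%:C) ^+ n.
  rewrite (perm_big _ (perm_to_rem b0B)) /G -[_ :: s]/(map _ (b0 :: rem b0 B2)).
  by rewrite big_map; apply: eq_bigr => b _; rewrite /c divfK.
have u1 b : b \in B2 -> normc (b / rho%:C) = 1.
  rewrite mem_filter nrm => /andP[/eqP -> _].
  by rewrite -nb0 divff// gt_eqF.
apply: (@positivity_average f G (fun n => (n%:R ^+ D * rho ^+ n)^-1) 1).
- by move=> n n0; rewrite invr_gt0 mulr_gt0// exprn_gt0// ltr0n.
(* The default [0] outside [B2] is there because [trig_seq_sum] asks every index to give a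
   trigonometric sum. *)
- apply: (@trig_seq_ext _ (fun n => \sum_(b <- B2) if b \in B2 then
     (Q b)`_D * (b / rho%:C) ^+ n else 0)).
    by move=> n; rewrite GE; apply: eq_big_seq => b ->.
  apply: trig_seq_sum => b.
  case: (b \in B2) (u1 b) => [/(_ isT) ?|_]; last exact: trig_seq_cst.
  exact: trig_seq_mono.
- apply: rarely_small_trig; first exact: u1.
    rewrite /c divfK// -lead_coefE lead_coef_eq0.
    by case: (B1B _ b0B1).
  move=> w /mapP[b bB ->].
  have uB2 : uniq B2 by rewrite !filter_uniq.
  move: bB; rewrite mem_rem_uniq// inE => /andP[bb0 bB].
  split; first exact: u1.
  move=> d d0; rewrite !expr_div_n; apply/eqP => /divIf eqb.
  have /eqP[] : b0 ^+ d != b ^+ d.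
    apply: ndB => //; last by rewrite eq_sym.
      by case: (B1B _ b0B1).
    by move: bB; rewrite mem_filter => /andP[_ /B1B[]].
  by apply: eqb; rewrite expf_neq0.
(* The error due to [b]: its normalized term, minus its share of [G] when [b] has maximal
   modulus. *)
pose E b n := (Q b).[n%:R] * (b / rho%:C) ^+ n / n%:R ^+ D -
  (if normc b == normc b1 then (Q b)`_D * (b / rho%:C) ^+ n else 0).
apply: (@decays_ext (fun n => \sum_(b <- B1) E b n) _ (maxn N0 1)) => [n|].
  rewrite geq_max => /andP[nN0 n1].
  rewrite sumrB GE; congr (_ - _); last first.
    by rewrite [RHS]big_filter [RHS]big_mkcond.
  have -> : (f n / (n%:R ^+ D * rho ^+ n))%:C =
      (f n)%:C / (n%:R ^+ D * rho%:C ^+ n).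
    rewrite (rmorphM (real_complex R)) fmorphV (rmorphM (real_complex R)).
    by rewrite !(rmorphXn (real_complex R)) (rmorph_nat (real_complex R)).
  rewrite hf1// mulr_suml.
  apply: eq_bigr => b _; rewrite expr_div_n; field.
  by rewrite expf_neq0// expf_neq0// pnatr_eq0 -lt0n.
apply: decays_sum => b bB1; rewrite /E.
have b1rho : normc b1 = rho by [].
(* At maximal modulus the degree is at most [D] and the coefficient of degree [D] cancels; at
   smaller modulus the geometric factor decays. *)
case: eqP => [nb|nb].
  have sz : (size (Q b) <= D.+1)%N.
    have := hb0 b; rewrite mem_filter nb eqxx bB1 => /(_ isT).
    by rewrite leEnat /D; case: (size (Q b0)) => // /leqW.
  have vb : normc (b / rho%:C) = 1 by rewrite nrm nb b1rho divff// gt_eqF.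
  apply: (@decays_ext (fun n => \sum_(j <- index_enum 'I_D)
     (Q b)`_j * n%:R ^+ j * (b / rho%:C) ^+ n / n%:R ^+ D) _ 1) => [n n1|].
    rewrite (horner_coef_wide _ sz) big_ord_recr /= !mulrDl !mulr_suml.
    have nD : n%:R ^+ D != 0 :> C by rewrite expf_neq0// pnatr_eq0 -lt0n.
    by rewrite (mulrAC _ _ (n%:R ^+ D)^-1) mulfK// addrK.
  by apply: decays_sum => j _; apply: decays_monomial; right.
have vb : normc (b / rho%:C) < 1.
  rewrite nrm ltr_pdivrMr// mul1r lt_neqAle -b1rho hb1// andbT.
  exact/eqP.
apply: (@decays_ext (fun n => \sum_(j <- index_enum 'I_(size (Q b)))
     (Q b)`_j * n%:R ^+ j * (b / rho%:C) ^+ n / n%:R ^+ D) _ 1) => [n n1|].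
  by rewrite subr0 horner_coef !mulr_suml.
by apply: decays_sum => j _; apply: decays_monomial; left.
Qed.

End DominantTerm.

(** * From averages to natural density *)

Section Density.
Variable R : realType.

Lemma counting_functionE (P : pred nat) (x : R) : 0 <= x ->
  counting_function [set n | P n] x = (\sum_(i < (Num.truncn x).+1) P i)%N.
Proof.
move=> x0; rewrite /counting_function.
have : forall n, (n < (Num.truncn x).+1)%N = (n%:R <= x).
  by move=> n; rewrite ltnS truncn_ge_nat.
move: (Num.truncn x).+1 => N hN.
have -> : [set n : nat | n%:R <= x /\ [set n | P n] n] =
    [set` [fset n in [seq n <- iota 0 N | P n]]%fset].
  apply/seteqP; split => n /=; rewrite !inE mem_filter mem_iota add0n /= hN.
    by move=> [nx Pn]; rewrite Pn.
  by move=> /andP[].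
rewrite set_fsetK card_fseq undup_id ?filter_uniq ?iota_uniq// size_filter.
rewrite -sum1_count big_mkcond -[N in iota 0 N]subn0 -/(index_iota 0 N) big_mkord.
by apply: eq_bigr => i _; case: (P i).
Qed.

(** For real [x] the count runs over [N] indices with [x <= N%:R <= x + 1], so replacing [N%:R] by
    [x] costs at most the absolute value of [l]. *)
Lemma average_natural_density (P : pred nat) (l : R) :
  has_average (fun n => (P n)%:R) l -> has_natural_density [set n | P n] l.
Proof.
move=> hl; apply/cvgrPdist_lt => e e0.
have e2 : 0 < e / 8 by lra.
have [N0 hN0] := hl _ e2.
near=> x.
have x1 : 1 <= x by near: x; apply: nbhs_pinfty_ge; exact: num_real.
have xN : N0%:R <= x by near: x; apply: nbhs_pinfty_ge; exact: num_real.
(* This makes the rounding cost at most [e / 2 * x]; the average itself costs at most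
   [e / 8 * (x + 1)], which is at most [e / 4 * x]. *)
have xl : `|l| / (e / 2) <= x by near: x; apply: nbhs_pinfty_ge; exact: num_real.
have x0 : 0 < x by lra.
rewrite counting_functionE ?ltW//; set N := (Num.truncn x).+1.
have /andP[N1 N2] : x <= N%:R <= x + 1.
  rewrite ltW ?truncnS_gt//= /N -natr1 lerD2r.
  by rewrite truncn_le ltW.
have /hN0 : (N0 <= N)%N by rewrite -(ler_nat R); exact: le_trans xN N1.
rewrite -natr_sum; set S : R := _%:R => hS.
rewrite distrC -(ltr_pM2r x0) -[X in _ * X < _](gtr0_norm x0) -normrM.
have -> : (x^-1 * S - l) * x = (S - l * N%:R) + l * (N%:R - x).
  by field; rewrite gt_eqF.
apply: le_lt_trans (ler_normD _ _) _; rewrite normrM.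
have b1 : `|l| * `|N%:R - x| <= `|l|.
  by apply: ler_piMr => //; rewrite ger0_norm; lra.
have b2 : `|l| <= x * (e / 2) by rewrite -ler_pdivrMr//; lra.
have b3 : e / 8 * N%:R <= e / 8 * (x + 1) by apply: ler_wpM2l => //; lra.
have b4 : e / 8 * (x + 1) <= e / 8 * (x + x) by apply: ler_wpM2l => //; lra.
have b5 : 0 < e * x by apply: mulr_gt0.
lra.
Unshelve. all: by end_near.
Qed.

End Density.

Theorem theorem1 (R : realType) (f : nat -> R)
  (hf : recurrence_sequence f) :
  exists d : R, has_natural_density [set n : nat | f n > 0] d.
Proof.
have [g [/binexp_polynomial_form[s [s0 hs]] [N0 fg]]] :=
  recurrence_eventually_binexp hf.
have [M [M0 hM]] := residue_class_form s0 hs.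
suff [l hl] : exists l : R, has_average (fun n => (0 < f n)%R%:R) l.
  by exists l; exact: average_natural_density.
apply: (@has_average_residue_classes _ _ M 1) => // [n|r _].
  by case: (0 < f n)%R; rewrite ?normr1 ?normr0.
have [B [Q [uB B0 ndB gB]]] := hM r.
apply: (@nondegenerate_positivity_average _ (fun n => f (n * M + r)%N) B Q N0)
  => // n hn.
(* As [M] is positive, [n <= n * M + r], so the threshold [N0] of the closed form serves every
   class. *)
rewrite fg ?gB//; apply: leq_trans hn _.
by apply: leq_trans (leq_addr _ _); exact: leq_pmulr.
Qed.
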